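(* For integers $m,n$ with $1\le m<\frac n3$, $\pi_1(\mathbb{Z}_n,c_m)\cong\mathbb{Z}$.
   Context: A Čech closure space $(X,c)$ is a set $X$ with a map $c:\mathcal{P}(X)\to\mathcal{P}(X)$ such that $c(\emptyset)=\emptyset$, $A\subseteq c(A)$, and $c(A\cup B)=c(A)\cup c(B)$ (not assumed $c^2=c$). A topological space is a closure space via its topological closure. A map $f:(X,c_X)\to(Y,c_Y)$ is continuous iff $f(c_X(A))\subseteq c_Y(f(A))$ for all $A\subseteq X$. $U$ is a neighborhood of $x$ if $x\in X\setminus c(X\setminus U)$. The product closure structure on $X\times Y$ is the one in which, at each point $(x,y)$, the sets $V\times W$ ($V$ a neighborhood of $x$, $W$ a neighborhood of $y$) form a local base of neighborhoods. $(\mathbb{Z}_n,c_m)$ is the set $\mathbb{Z}_n=\mathbb{Z}/n\mathbb{Z}$ with $c_m([k])=\{[k-m],\dots,[k-1],[k],[k+1],\dots,[k+m]\}$ and $c_m(A)=\bigcup_{[k]\in A}c_m([k])$. $I=[0,1]$ has its usual topology. $\pi_1(X,* )$ is the group of homotopy classes rel $\partial I$ of continuous loops $v:I\to(X,c)$ based at $*$ (homotopies are continuous maps $I\times I\to (X,c)$ fixed on $\partial I$), with product $[v][w]=[v\star w]$ given by concatenation; the basepoint is suppressed from the notation. *)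

(* Defs.v *)
From HB Require Import structures.
From mathcomp Require Import all_boot all_order all_algebra.
From mathcomp Require Import ring lra.
From mathcomp Require Import all_classical all_reals all_analysis.
Set Implicit Arguments.
Unset Strict Implicit.
Unset Printing Implicit Defensive.
Import Order.TTheory GRing.Theory Num.Theory.
Import numFieldNormedType.Exports.
Local Open Scope classical_set_scope.
Local Open Scope ring_scope.
Local Open Scope quotient_scope.

Record cechSpace := CechSpace {
  cech_sort :> Type;
  ccl : set cech_sort -> set cech_sort;
  ccl0 : ccl set0 = set0;
  sub_ccl : forall A, A `<=` ccl A;
  cclU : forall A B, ccl (A `|` B) = ccl A `|` ccl B }.

Arguments ccl {c} A.

Definition ccontinuous (X Y : cechSpace) (f : X -> Y) : Prop :=
  forall A : set X, f @` ccl A `<=` ccl (f @` A).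

Definition cnbhs (X : cechSpace) (x : X) (U : set X) : Prop :=
  (~` ccl (~` U)) x.

Lemma ccl_mono (X : cechSpace) (A B : set X) : A `<=` B -> ccl A `<=` ccl B.
Proof. by move=> /setUidPr <-; rewrite cclU; left. Qed.

Lemma cnbhs_in (X : cechSpace) (x : X) U : cnbhs x U -> U x.
Proof. by move=> h; apply: contrapT => h'; apply: h; apply: sub_ccl. Qed.

Lemma cnbhsT (X : cechSpace) (x : X) : cnbhs x setT.
Proof. by rewrite /cnbhs setCT ccl0. Qed.

Arguments cnbhsT {X} x.

Lemma cnbhsI (X : cechSpace) (x : X) U V :
  cnbhs x U -> cnbhs x V -> cnbhs x (U `&` V).
Proof. by move=> hU hV; rewrite /cnbhs setCI cclU => -[/hU|/hV]. Qed.

Lemma cnbhsS (X : cechSpace) (x : X) U V :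
  U `<=` V -> cnbhs x U -> cnbhs x V.
Proof. by move=> UV hU hV; apply: hU; apply: (ccl_mono _ hV) => y /[swap] /UV. Qed.

Lemma ccl_cnbhsP (X : cechSpace) (x : X) A :
  ccl A x <-> forall U, cnbhs x U -> A `&` U !=set0.
Proof.
split=> [Ax U pU|h].
  apply: contrapT => nAU; apply: pU; apply: (ccl_mono _ Ax) => y Ay Uy.
  by apply: nAU; exists y.
apply: contrapT => nA; have [] := h (~` A).
  by rewrite /cnbhs setCK.
by move=> y [].
Qed.

Lemma ccontinuousP (X Y : cechSpace) (f : X -> Y) :
  ccontinuous f <-> forall x V, cnbhs (f x) V -> cnbhs x (f @^-1` V).
Proof.
split=> [cf x V hV hx|h A _ [x Ax <-]].
  apply: hV; have /cf : (f @` ccl (~` (f @^-1` V))) (f x) by exists x.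
  by apply: ccl_mono => _ [y /= Vy <-].
apply/ccl_cnbhsP => V /h; move/ccl_cnbhsP : Ax => /[apply] -[y [Ay Vy]].
by exists (f y); split=> //; exists y.
Qed.

Lemma ccontinuous_comp (X Y Z : cechSpace) (f : X -> Y) (g : Y -> Z) :
  ccontinuous f -> ccontinuous g -> ccontinuous (g \o f).
Proof.
by move=> /ccontinuousP cf /ccontinuousP cg; apply/ccontinuousP => x V /cg/cf.
Qed.

Lemma ccontinuous_cst (X Y : cechSpace) (y : Y) : ccontinuous (fun _ : X => y).
Proof.
apply/ccontinuousP => x V /cnbhs_in Vy.
have := cnbhsT x; apply: cnbhsS => z _ /=; exact: Vy.
Qed.

Lemma ccontinuous_paste (X Y : cechSpace) (A B : set X) (f g h : X -> Y) :
  ccl A `<=` A -> ccl B `<=` B -> A `|` B = setT ->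
  {in A, f =1 g} -> {in B, f =1 h} ->
  ccontinuous g -> ccontinuous h -> ccontinuous f.
Proof.
move=> clA clB AB fg fh cg ch S _ [x Sx <-].
rewrite -(setIT S) -AB setIUr cclU in Sx.
case: Sx => Sx.
  have Ax : A x by apply: clA; apply: (ccl_mono _ Sx) => ? [].
  rewrite fg ?inE//; have /cg : (g @` ccl (S `&` A)) (g x) by exists x.
  by apply: ccl_mono => _ [y [Sy Ay] <-]; exists y; rewrite ?fg ?inE.
have Bx : B x by apply: clB; apply: (ccl_mono _ Sx) => ? [].
rewrite fh ?inE//; have /ch : (h @` ccl (S `&` B)) (h x) by exists x.
by apply: ccl_mono => _ [y [Sy By] <-]; exists y; rewrite ?fh ?inE.
Qed.

Lemma ccontinuous_closed (X Y : cechSpace) (f : X -> Y) (B : set Y) :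
  ccontinuous f -> ccl B `<=` B -> ccl (f @^-1` B) `<=` f @^-1` B.
Proof.
move=> cf clB x Bx; apply: clB.
have /cf : (f @` ccl (f @^-1` B)) (f x) by exists x.
by apply: ccl_mono => _ [y ? <-].
Qed.

Definition top_cech (T : topologicalType) : cechSpace :=
  CechSpace (@closure0 T) (@subset_closure T) (@closureU T).

Lemma cnbhs_topE (T : topologicalType) (x : top_cech T) U :
  cnbhs x U <-> nbhs (x : T) U.
Proof.
by rewrite -[X in _ <-> X]/(interior U x) -[in X in _ <-> X](setCK U)
  interiorC.
Qed.

Lemma ccontinuous_top (S T : topologicalType) (f : S -> T) :
  continuous f -> ccontinuous (f : top_cech S -> top_cech T).
Proof.
by move=> cf; apply/ccontinuousP => x V /cnbhs_topE/cf ?; apply/cnbhs_topE.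
Qed.

Section product.
Variables X Y : cechSpace.

(* [cnbhs_prodP] below shows that this is the closure structure for which the
   sets [V `*` W] form a local base of neighborhoods at each point. *)
Definition prod_ccl (A : set (X * Y)) : set (X * Y) :=
  [set p | forall V W, cnbhs p.1 V -> cnbhs p.2 W -> A `&` (V `*` W) !=set0].

Lemma prod_ccl0 : prod_ccl set0 = set0.
Proof.
rewrite -subset0 => p /(_ _ _ (cnbhsT _) (cnbhsT _)).
by rewrite set0I => -[].
Qed.

Lemma sub_prod_ccl A : A `<=` prod_ccl A.
Proof. by move=> p Ap V W /cnbhs_in ? /cnbhs_in ?; exists p. Qed.

Lemma prod_cclU A B : prod_ccl (A `|` B) = prod_ccl A `|` prod_ccl B.
Proof.
apply/seteqP; split=> p; last first.
  by move=> [h|h] V W pV pW; have [q [? ?]] := h _ _ pV pW;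
    exists q; split=> //; [left|right].
move=> h; apply: contrapT => /not_orP[].
move=> /existsNP[V] /existsNP[W] /not_implyP[pV] /not_implyP[pW] nA.
move=> /existsNP[V'] /existsNP[W'] /not_implyP[pV'] /not_implyP[pW'] nB.
have [q [AB [[qV qV'] [qW qW']]]] := h _ _ (cnbhsI pV pV') (cnbhsI pW pW').
by case: AB => ?; [apply: nA|apply: nB]; exists q.
Qed.

Definition prod_cech : cechSpace :=
  CechSpace prod_ccl0 sub_prod_ccl prod_cclU.

Lemma cnbhs_prodP (p : prod_cech) U :
  cnbhs p U <->
  exists V W, [/\ cnbhs p.1 V, cnbhs p.2 W & V `*` W `<=` U].
Proof.
split=> [|[V] [W] [pV pW VWU] /(_ _ _ pV pW) [q [nU /VWU]]//].
move=> /existsNP[V] /existsNP[W] /not_implyP[pV] /not_implyP[pW] nA.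
exists V, W; split=> // q qVW; apply: contrapT => nU.
by apply: nA; exists q.
Qed.

End product.

Lemma ccontinuous_fst (X Y : cechSpace) : ccontinuous (@fst X Y : prod_cech X Y -> X).
Proof.
apply/ccontinuousP => p V pV; apply/cnbhs_prodP.
by exists V, setT; split=> //; [exact: cnbhsT|move=> ? []].
Qed.

Lemma ccontinuous_snd (X Y : cechSpace) : ccontinuous (@snd X Y : prod_cech X Y -> Y).
Proof.
apply/ccontinuousP => p V pV; apply/cnbhs_prodP.
by exists setT, V; split=> //; [exact: cnbhsT|move=> ? []].
Qed.

Lemma ccontinuous_pair (Z X Y : cechSpace) (f : Z -> X) (g : Z -> Y) :
  ccontinuous f -> ccontinuous g ->
  ccontinuous (fun z => (f z, g z) : prod_cech X Y).
Proof.
move=> /ccontinuousP cf /ccontinuousP cg; apply/ccontinuousP => z U.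
move=> /cnbhs_prodP[V [W [/cf fV /cg gW VWU]]].
by apply: (@cnbhsS _ _ _ _ _ (cnbhsI fV gW)) => y [? ?]; apply: VWU.
Qed.

Lemma ccontinuous_top2 (S T U : topologicalType) (f : S * T -> U) :
  continuous f ->
  ccontinuous (f : prod_cech (top_cech S) (top_cech T) -> top_cech U).
Proof.
move=> cf; apply/ccontinuousP => p V /cnbhs_topE/cf [[A B] /= [pA pB] ABV].
by apply/cnbhs_prodP; exists A, B; split=> //; apply/cnbhs_topE.
Qed.

Section unit_interval.
Variable R : realType.

Definition uitv : topologicalType := set_type `[0%R : R, 1%R]%classic.

Lemma uitv_ge0 (t : uitv) : 0 <= val t.
Proof. by have /set_mem := valP t; rewrite /= in_itv /= => /andP[]. Qed.

Lemma uitv_le1 (t : uitv) : val t <= 1.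
Proof. by have /set_mem := valP t; rewrite /= in_itv /= => /andP[]. Qed.

Lemma uitv0_subproof : (0 : R) \in `[0%R : R, 1%R]%classic.
Proof. by rewrite inE /= in_itv /= lexx ler01. Qed.

Lemma uitv1_subproof : (1 : R) \in `[0%R : R, 1%R]%classic.
Proof. by rewrite inE /= in_itv /= lexx ler01. Qed.

Definition uitv0 : uitv := exist _ 0 uitv0_subproof.
Definition uitv1 : uitv := exist _ 1 uitv1_subproof.

Lemma clamp_subproof (x : R) : Num.max 0 (Num.min x 1) \in `[0%R : R, 1%R]%classic.
Proof.
by rewrite inE /= in_itv /= le_max lexx /= ge_max ler01 ge_min lexx orbT.
Qed.

Definition clamp (x : R) : uitv :=
  exist _ (Num.max 0 (Num.min x 1)) (clamp_subproof x).

Lemma val_clamp (x : R) : 0 <= x <= 1 -> val (clamp x) = x.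
Proof. by move=> /andP[x0 x1] /=; rewrite (min_idPl x1) (max_idPr x0). Qed.

Lemma clampK (t : uitv) : clamp (val t) = t.
Proof. by apply: val_inj; rewrite val_clamp// uitv_ge0 uitv_le1. Qed.

Lemma clamp_le0 (x : R) : x <= 0 -> clamp x = uitv0.
Proof.
move=> x0; apply: val_inj => /=; apply/max_idPl.
by rewrite ge_min x0.
Qed.

Lemma clamp_ge1 (x : R) : 1 <= x -> clamp x = uitv1.
Proof.
move=> x0; apply: val_inj => /=.
by rewrite (min_idPr x0); apply/max_idPr.
Qed.

Lemma continuous_uitv_val : continuous (val : uitv -> R).
Proof. exact: initial_continuous. Qed.

Lemma continuous_clamp_comp (T : topologicalType) (f : T -> R) :
  continuous f -> continuous (fun x => clamp (f x)).
Proof.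
move=> cf; apply: (@continuous_comp_initial _ _ _ (val : uitv -> R)) => x.
apply: (@continuous_max R T (cst 0) (fun y => Num.min (f y) 1)).
  exact: cvg_cst.
by apply: (@continuous_min R T f (cst 1)); [exact: cf|exact: cvg_cst].
Qed.

Definition I : cechSpace := top_cech uitv.
Definition II : cechSpace := prod_cech I I.


Lemma ccontinuous_if (Z X : cechSpace) (r : Z -> I) (c : R) (f g : Z -> X) :
  ccontinuous r -> ccontinuous f -> ccontinuous g ->
  (forall z, val (r z) = c -> f z = g z) ->
  ccontinuous (fun z => if val (r z) <= c then f z else g z).
Proof.
move=> cr cf cg fg.
have cv : continuous (val : uitv -> R) by exact: continuous_uitv_val.
apply: (@ccontinuous_paste _ _ (r @^-1` [set t | val t <= c])
  (r @^-1` [set t | c <= val t]) _ f g) => //.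
- apply: ccontinuous_closed => //.
  by apply: (@preimage_closed _ _ (val : uitv -> R) [set x | x <= c]);
    [move=> x _; exact: cv|exact: closed_le].
- apply: ccontinuous_closed => //.
  by apply: (@preimage_closed _ _ (val : uitv -> R) [set x | c <= x]);
    [move=> x _; exact: cv|exact: closed_ge].
- by rewrite -subTset => z _ /=; case: (leP (val (r z)) c) => [|/ltW]; [left|right].
- by move=> z; rewrite inE /= => ->.
- move=> z; rewrite inE /= => cz; case: leP => // zc; apply: fg.
  by apply/eqP; rewrite eq_le zc.
Qed.

Lemma ccontinuous_clamp (f : uitv -> R) :
  continuous f -> ccontinuous (fun t : I => clamp (f t) : I).
Proof. by move=> /continuous_clamp_comp/ccontinuous_top. Qed.

Lemma continuous_affine (a b : R) : continuous (fun t : uitv => a * val t + b).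
Proof.
move=> t; have vt : (val : uitv -> R) x @[x --> t] --> (val t : R).
  exact: continuous_uitv_val.
exact: (cvgD (cvgM (cvg_cst a) vt) (cvg_cst b)).
Qed.

Lemma ccontinuous_affine (a b : R) :
  ccontinuous (fun t : I => clamp (a * val t + b) : I).
Proof. exact/ccontinuous_clamp/continuous_affine. Qed.

Section loops.
Variables (X : cechSpace) (x0 : X).

Record loop := Loop {
  loop_fun :> I -> X;
  loop_cont : ccontinuous loop_fun;
  loop_0 : loop_fun uitv0 = x0;
  loop_1 : loop_fun uitv1 = x0 }.

(* The second coordinate is the homotopy parameter. *)
Definition homotopic (v w : loop) : Prop :=
  exists H : II -> X, [/\ ccontinuous H,
    forall t, H (t, uitv0) = v t,
    forall t, H (t, uitv1) = w t,
    forall s, H (uitv0, s) = x0 &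
    forall s, H (uitv1, s) = x0].

Lemma homotopic_eq (v w : loop) : v =1 w -> homotopic v w.
Proof.
move=> vw; exists (fun p => v p.1); split=> //=.
- apply: (@ccontinuous_comp II I X fst v); last exact: loop_cont.
  exact: ccontinuous_fst.
- by move=> s; exact: loop_0.
- by move=> s; exact: loop_1.
Qed.

Lemma homotopic_refl (v : loop) : homotopic v v.
Proof. exact: homotopic_eq. Qed.

Lemma ccontinuous_prodmap (Z W Z' W' : cechSpace) (f : Z -> Z') (g : W -> W') :
  ccontinuous f -> ccontinuous g ->
  ccontinuous (fun p : prod_cech Z W => (f p.1, g p.2) : prod_cech Z' W').
Proof.
move=> cf cg; apply: ccontinuous_pair.
- apply: (@ccontinuous_comp (prod_cech Z W) Z Z' fst f) => //.
  exact: ccontinuous_fst.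
- apply: (@ccontinuous_comp (prod_cech Z W) W W' snd g) => //.
  exact: ccontinuous_snd.
Qed.

Lemma ccontinuous_id (Z : cechSpace) : ccontinuous (fun z : Z => z).
Proof. by move=> A _ [x Ax <-]; rewrite image_id. Qed.

Lemma ccontinuous_affine1 (H : II -> X) (a b : R) : ccontinuous H ->
  ccontinuous (fun p : II => H (clamp (a * val p.1 + b), p.2)).
Proof.
apply: (@ccontinuous_comp II II X
  (fun p : II => (clamp (a * val p.1 + b), p.2) : II) H).
apply: (@ccontinuous_prodmap I I I I (fun t => clamp (a * val t + b))
  (fun z => z)); last exact: ccontinuous_id.
exact: ccontinuous_affine.
Qed.

Lemma ccontinuous_affine2 (H : II -> X) (a b : R) : ccontinuous H ->
  ccontinuous (fun p : II => H (p.1, clamp (a * val p.2 + b))).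
Proof.
apply: (@ccontinuous_comp II II X
  (fun p : II => (p.1, clamp (a * val p.2 + b)) : II) H).
apply: (@ccontinuous_prodmap I I I I (fun z => z)
  (fun t => clamp (a * val t + b))); first exact: ccontinuous_id.
exact: ccontinuous_affine.
Qed.

Lemma homotopic_sym (v w : loop) : homotopic v w -> homotopic w v.
Proof.
move=> [H [cH H0 H1 Hl Hr]].
exists (fun p => H (p.1, clamp (- 1 * val p.2 + 1))); split => //.
- exact: ccontinuous_affine2.
- by move=> t /=; rewrite mulr0 add0r clamp_ge1.
- by move=> t /=; rewrite mulr1 addNr clamp_le0.
Qed.

Lemma homotopic_trans (v u w : loop) :
  homotopic u v -> homotopic v w -> homotopic u w.
Proof.
move=> [H [cH H0 H1 Hl Hr]] [K [cK K0 K1 Kl Kr]].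
exists (fun p => if val p.2 <= 2^-1 then H (p.1, clamp (2 * val p.2 + 0))
                 else K (p.1, clamp (2 * val p.2 + (-1)))); split.
- apply: (@ccontinuous_if II X snd 2^-1).
  + exact: ccontinuous_snd.
  + exact: ccontinuous_affine2.
  + exact: ccontinuous_affine2.
  + move=> p ->; rewrite divff ?pnatr_eq0// addr0 subrr.
    by rewrite clamp_ge1// clamp_le0// H1 K0.
- by move=> t /=; rewrite invr_ge0 ler0n mulr0 addr0 clamp_le0.
- move=> t /=; rewrite leNgt invf_lt1// ltr1n/= mulr1 clamp_ge1 ?K1//.
  by lra.
- by move=> s /=; case: ifP.
- by move=> s /=; case: ifP.
Qed.

(* In each branch the argument of [clamp] lies in [0, 1]. *)
Definition concat_fun (v w : I -> X) (t : I) : X :=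
  if val t <= 2^-1 then v (clamp (2 * val t)) else w (clamp (2 * val t - 1)).

Lemma concat_cont (v w : loop) : ccontinuous (concat_fun v w).
Proof.
apply: (@ccontinuous_if I X (fun z => z) 2^-1).
- exact: ccontinuous_id.
- apply: (@ccontinuous_comp I I X (fun t : I => clamp (2 * val t) : I) v).
    under eq_fun do rewrite -[_ * _]addr0.
    exact: ccontinuous_affine.
  exact: loop_cont.
- apply: (@ccontinuous_comp I I X (fun t : I => clamp (2 * val t - 1) : I) w).
    exact: ccontinuous_affine.
  exact: loop_cont.
- move=> t ->; rewrite divff ?pnatr_eq0// subrr.
  by rewrite clamp_ge1// clamp_le0// loop_0 loop_1.
Qed.

Arguments concat_cont : clear implicits.

Lemma concat_0 (v w : loop) : concat_fun v w uitv0 = x0.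
Proof.
by rewrite /concat_fun /= invr_ge0 ler0n mulr0 clamp_le0// loop_0.
Qed.

Lemma concat_1 (v w : loop) : concat_fun v w uitv1 = x0.
Proof.
rewrite /concat_fun /= leNgt invf_lt1// ltr1n/= mulr1 clamp_ge1 ?loop_1//.
by lra.
Qed.

Definition concat (v w : loop) : loop :=
  Loop (concat_cont v w) (concat_0 v w) (concat_1 v w).

Definition cst_loop : loop :=
  Loop (@ccontinuous_cst I X x0) erefl erefl.

Lemma rev_cont (v : loop) : ccontinuous (fun t : I => v (clamp (1 - val t))).
Proof.
apply: (@ccontinuous_comp I I X (fun t : I => clamp (1 - val t) : I) v).
  under eq_fun do rewrite addrC -mulN1r.
  exact: ccontinuous_affine.
exact: loop_cont.
Qed.

Arguments rev_cont : clear implicits.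

Lemma rev_0 (v : loop) : v (clamp (1 - val uitv0)) = x0.
Proof. by rewrite subr0 clamp_ge1// loop_1. Qed.

Lemma rev_1 (v : loop) : v (clamp (1 - val uitv1)) = x0.
Proof. by rewrite subrr clamp_le0// loop_0. Qed.

Definition rev_loop (v : loop) : loop := Loop (rev_cont v) (rev_0 v) (rev_1 v).

Lemma homotopic_concat (v v' w w' : loop) :
  homotopic v v' -> homotopic w w' -> homotopic (concat v w) (concat v' w').
Proof.
move=> [H [cH H0 H1 Hl Hr]] [K [cK K0 K1 Kl Kr]].
exists (fun p => if val p.1 <= 2^-1 then H (clamp (2 * val p.1 + 0), p.2)
                 else K (clamp (2 * val p.1 + (-1)), p.2)); split.
- apply: (@ccontinuous_if II X fst 2^-1).
  + exact: ccontinuous_fst.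
  + exact: ccontinuous_affine1.
  + exact: ccontinuous_affine1.
  + move=> p ->; rewrite divff ?pnatr_eq0// addr0 subrr.
    by rewrite clamp_ge1// clamp_le0// Hr Kl.
- by move=> t; rewrite /= /concat_fun addr0 H0 K0.
- by move=> t; rewrite /= /concat_fun addr0 H1 K1.
- by move=> s /=; rewrite invr_ge0 ler0n mulr0 addr0 clamp_le0.
- move=> t /=; rewrite leNgt invf_lt1// ltr1n/= mulr1 clamp_ge1 ?Kr//.
  by lra.
Qed.

Lemma homotopic_rev (v w : loop) :
  homotopic v w -> homotopic (rev_loop v) (rev_loop w).
Proof.
move=> [H [cH H0 H1 Hl Hr]].
exists (fun p => H (clamp (- 1 * val p.1 + 1), p.2)); split.
- exact: ccontinuous_affine1.
- by move=> t; rewrite /= mulN1r addrC H0.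
- by move=> t; rewrite /= mulN1r addrC H1.
- by move=> t /=; rewrite mulr0 add0r clamp_ge1.
- by move=> t /=; rewrite mulr1 addNr clamp_le0.
Qed.

Lemma homotopic_reparam (u v w : loop) (f g : uitv -> uitv) :
  continuous f -> continuous g -> f uitv0 = g uitv0 -> f uitv1 = g uitv1 ->
  (forall t, v t = u (f t)) -> (forall t, w t = u (g t)) -> homotopic v w.
Proof.
move=> cf cg fg0 fg1 vE wE.
have cv : continuous (val : uitv -> R) by exact: continuous_uitv_val.
exists (fun p : II =>
  u (clamp ((1 - val p.2) * val (f p.1) + val p.2 * val (g p.1)))); split.
- apply: (@ccontinuous_comp II I X (fun p : II =>
    clamp ((1 - val p.2) * val (f p.1) + val p.2 * val (g p.1)) : I) u);
    last exact: loop_cont.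
  apply: (@ccontinuous_top2 uitv uitv uitv (fun p : uitv * uitv =>
    clamp ((1 - val p.2) * val (f p.1) + val p.2 * val (g p.1)))).
  apply: continuous_clamp_comp => p.
  have c2 : (fun q : uitv * uitv => val q.2) @ p --> val p.2.
    by apply: (continuous_comp _ (cv _)); exact: cvg_snd.
  have cf1 : (fun q : uitv * uitv => val (f q.1)) @ p --> val (f p.1).
    by apply: (continuous_comp _ (cv _)); apply: (continuous_comp _ (cf _));
      exact: cvg_fst.
  have cg1 : (fun q : uitv * uitv => val (g q.1)) @ p --> val (g p.1).
    by apply: (continuous_comp _ (cv _)); apply: (continuous_comp _ (cg _));
      exact: cvg_fst.
  apply: cvgD; apply: cvgM => //.
  by apply: cvgB => //; exact: cvg_cst.
- by move=> t /=; rewrite subr0 mul1r mul0r addr0 clampK vE.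
- by move=> t /=; rewrite subrr mul0r mul1r add0r clampK wE.
- by move=> s /=; rewrite fg0 -mulrDl subrK mul1r clampK -wE loop_0.
- by move=> s /=; rewrite fg1 -mulrDl subrK mul1r clampK -wE loop_1.
Qed.

Lemma concatcl (v : loop) : homotopic (concat cst_loop v) v.
Proof.
apply: (@homotopic_reparam v _ _ (fun t => clamp (2 * val t + (- 1))) id).
- exact/continuous_clamp_comp/continuous_affine.
- by move=> t; exact: cvg_id.
- by rewrite clamp_le0//= mulr0 add0r lerN10.
- by rewrite clamp_ge1//= mulr1; lra.
- move=> t; rewrite /= /concat_fun -![sval t]/(val t); case: ifPn => // t2.
  by rewrite clamp_le0 ?loop_0//; lra.
- by [].
Qed.

Lemma concatlc (v : loop) : homotopic (concat v cst_loop) v.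
Proof.
apply: (@homotopic_reparam v _ _ (fun t => clamp (2 * val t + 0)) id).
- exact/continuous_clamp_comp/continuous_affine.
- by move=> t; exact: cvg_id.
- by rewrite clamp_le0//= mulr0 addr0.
- by rewrite clamp_ge1//= mulr1; lra.
- move=> t; rewrite /= /concat_fun -![sval t]/(val t) addr0.
  case: (leP (val t)) => // t2.
  by rewrite clamp_ge1 ?loop_1//; lra.
- by [].
Qed.

Lemma continuous_fold : continuous (fun t : uitv => `|2 * val t - 1| : R).
Proof. by move=> t; exact: (cvg_norm (@continuous_affine 2 (- 1) t)). Qed.

Lemma concat_revl (v : loop) : homotopic (concat (rev_loop v) v) cst_loop.
Proof.
apply: (@homotopic_reparam v _ _ (fun t => clamp `|2 * val t - 1|)
  (fun=> uitv1)).
- exact/continuous_clamp_comp/continuous_fold.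
- exact: cst_continuous.
- by rewrite clamp_ge1//= mulr0 sub0r normrN1.
- by rewrite clamp_ge1//= mulr1 ger0_norm; lra.
- move=> t; have t0 := uitv_ge0 t; have t1 := uitv_le1 t.
  rewrite [LHS]/(concat_fun _ _ t) /concat_fun; case: (leP (val t)) => t2.
    rewrite [LHS]/(v (clamp (1 - val (clamp _)))).
    rewrite val_clamp; last by apply/andP; split; lra.
    by rewrite ler0_norm ?opprB//; lra.
  by rewrite ger0_norm//; lra.
- by move=> t; rewrite loop_1.
Qed.

Lemma concat_revr (v : loop) : homotopic (concat v (rev_loop v)) cst_loop.
Proof.
apply: (@homotopic_reparam v _ _ (fun t => clamp (1 - `|2 * val t - 1|))
  (fun=> uitv0)).
- apply: continuous_clamp_comp => t.
  by apply: (@cvgB R R^o) (@continuous_fold t); exact: cvg_cst.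
- exact: cst_continuous.
- by rewrite clamp_le0//= mulr0 sub0r normrN1 subrr.
- by rewrite clamp_le0//= mulr1 ger0_norm; lra.
- move=> t; have t0 := uitv_ge0 t; have t1 := uitv_le1 t.
  rewrite [LHS]/(concat_fun _ _ t) /concat_fun; case: (leP (val t)) => t2.
    by rewrite ler0_norm; [congr (v (clamp _)); lra|lra].
  rewrite [LHS]/(v (clamp (1 - val (clamp _)))).
  rewrite val_clamp; last by apply/andP; split; lra.
  by rewrite ger0_norm//; lra.
- by move=> t; rewrite loop_0.
Qed.

Lemma concatA (a b c : loop) :
  homotopic (concat a (concat b c)) (concat (concat a b) c).
Proof.
apply: homotopic_sym.
pose f (t : uitv) : R :=
  Num.min (Num.min (2 * val t + 0) (1 * val t + 4^-1)) (2^-1 * val t + 2^-1).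
apply: (@homotopic_reparam (concat a (concat b c)) _ _ (fun t => clamp (f t)) id).
- apply: continuous_clamp_comp => t; rewrite /f.
  apply: (@continuous_min R uitv
    (fun t => Num.min (2 * val t + 0) (1 * val t + 4^-1))
    (fun t => 2^-1 * val t + 2^-1)); last exact: continuous_affine.
  by apply: (@continuous_min R uitv (fun t => 2 * val t + 0)
    (fun t => 1 * val t + 4^-1)); exact: continuous_affine.
- by move=> t; exact: cvg_id.
- by rewrite clamp_le0// /f /= mulr0 add0r ge_min ge_min lexx.
- by rewrite clamp_ge1// /f /= !le_min; apply/andP; split; [apply/andP; split|]; lra.
- move=> t; have t0 := uitv_ge0 t; have t1 := uitv_le1 t.
  have h4 : 4^-1 = 2^-1 / 2 :> R by field.
  have h2 : 2^-1 * 2 = 1 :> R by field.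
  rewrite [LHS]/(concat_fun (concat_fun a b) c t).
  rewrite [RHS]/(concat_fun a (concat_fun b c) (clamp (f t))).
  rewrite /concat_fun.
  case: (leP (val t) 2^-1) => t2; last first.
    have ft : f t = 2^-1 * val t + 2^-1.
      by apply/min_idPr; rewrite le_min; apply/andP; split; lra.
    rewrite ft (@val_clamp (2^-1 * val t + 2^-1)); last by apply/andP; split; lra.
    rewrite ifN; last by rewrite -ltNge; lra.
    rewrite val_clamp; last by apply/andP; split; lra.
    rewrite ifN; last by rewrite -ltNge; lra.
    by congr (c (clamp _)); lra.
  rewrite (@val_clamp (2 * val t)); last by apply/andP; split; lra.
  case: (leP (val t) 4^-1) => t4.
    have ft : f t = 2 * val t.
      rewrite /f addr0 [Num.min (2 * _) _]min_l; last by lra.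
      by rewrite min_l//; lra.
    rewrite ft val_clamp; last by apply/andP; split; lra.
    rewrite ifT; last by lra.
    by rewrite ifT//; lra.
  have ft : f t = val t + 4^-1.
    rewrite /f mul1r addr0 [Num.min (2 * _) _]min_r; last by lra.
    by rewrite min_l//; lra.
  rewrite ft (@val_clamp (val t + 4^-1)); last by apply/andP; split; lra.
  rewrite ifN; last by rewrite -ltNge; lra.
  rewrite ifN; last by rewrite -ltNge; lra.
  rewrite val_clamp; last by apply/andP; split; lra.
  rewrite ifT; last by lra.
  by congr (b (clamp _)); lra.
- by [].
Qed.

HB.instance Definition _ := gen_eqMixin loop.
HB.instance Definition _ := gen_choiceMixin loop.

Definition homotopicb (v w : loop) : bool := `[< homotopic v w >].

Lemma homotopicb_refl : reflexive homotopicb.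
Proof. by move=> v; apply/asboolP; exact: homotopic_refl. Qed.

Lemma homotopicb_sym : symmetric homotopicb.
Proof. by move=> v w; apply: asbool_equiv_eq; split; exact: homotopic_sym. Qed.

Lemma homotopicb_trans : transitive homotopicb.
Proof.
move=> v u w /asboolP uv /asboolP vw; apply/asboolP.
exact: homotopic_trans uv vw.
Qed.

Canonical homotopic_equiv :=
  EquivRel homotopicb homotopicb_refl homotopicb_sym homotopicb_trans.

Definition pi1 : Type := {eq_quot homotopic_equiv}.

HB.instance Definition _ := Choice.on pi1.
HB.instance Definition _ := EqQuotient.on pi1.

Definition pi1_class (v : loop) : pi1 := \pi_pi1 v.

Lemma pi1_classP (v w : loop) : pi1_class v = pi1_class w <-> homotopic v w.
Proof.
split=> [/eqmodP/asboolP//|h]; apply/eqmodP; exact/asboolP.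
Qed.

Lemma pi1_classK (a : pi1) : pi1_class (repr a) = a.
Proof. exact: reprK. Qed.

Lemma repr_pi1_class (v : loop) : homotopic (repr (pi1_class v)) v.
Proof. by apply/pi1_classP; rewrite pi1_classK. Qed.

Definition pi1_mul (a b : pi1) : pi1 := pi1_class (concat (repr a) (repr b)).
Definition pi1_one : pi1 := pi1_class cst_loop.
Definition pi1_inv (a : pi1) : pi1 := pi1_class (rev_loop (repr a)).

Lemma pi1_mulE (v w : loop) :
  pi1_mul (pi1_class v) (pi1_class w) = pi1_class (concat v w).
Proof. by apply/pi1_classP/homotopic_concat; exact: repr_pi1_class. Qed.

Lemma pi1_invE (v : loop) : pi1_inv (pi1_class v) = pi1_class (rev_loop v).
Proof. by apply/pi1_classP/homotopic_rev; exact: repr_pi1_class. Qed.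

Lemma pi1_mulA : associative pi1_mul.
Proof.
move=> a b c; rewrite -[a]pi1_classK -[b]pi1_classK -[c]pi1_classK.
by rewrite !pi1_mulE; apply/pi1_classP; exact: concatA.
Qed.

Lemma pi1_mul1 : left_id pi1_one pi1_mul.
Proof.
by move=> a; rewrite -[a]pi1_classK pi1_mulE; apply/pi1_classP; exact: concatcl.
Qed.

Lemma pi1_mulr1 : right_id pi1_one pi1_mul.
Proof.
by move=> a; rewrite -[a]pi1_classK pi1_mulE; apply/pi1_classP; exact: concatlc.
Qed.

Lemma pi1_mulV : left_inverse pi1_one pi1_inv pi1_mul.
Proof.
move=> a; rewrite -[a]pi1_classK pi1_invE pi1_mulE.
by apply/pi1_classP; exact: concat_revl.
Qed.

Lemma pi1_mulrV : right_inverse pi1_one pi1_inv pi1_mul.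
Proof.
move=> a; rewrite -[a]pi1_classK pi1_invE pi1_mulE.
by apply/pi1_classP; exact: concat_revr.
Qed.

HB.instance Definition _ := isGroup.Build pi1
  pi1_mulA pi1_mul1 pi1_mulr1 pi1_mulV pi1_mulrV.

Lemma pi1_classM (v w : loop) :
  (pi1_class v * pi1_class w)%g = pi1_class (concat v w).
Proof. exact: pi1_mulE. Qed.

End loops.
End unit_interval.

Arguments pi1 R {X} x0.

Section cyclic.
Variables n m : nat.

(* ['Z_n] is Z/nZ only for [1 < n]. *)
Definition cyc_ccl (A : set 'Z_n) : set 'Z_n :=
  \bigcup_(k in A) [set k + j%:~R | j in [set j : int | - m%:Z <= j <= m%:Z]].

Lemma cyc_ccl0 : cyc_ccl set0 = set0.
Proof. exact: bigcup_set0. Qed.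

Lemma sub_cyc_ccl A : A `<=` cyc_ccl A.
Proof.
move=> k Ak; exists k => //; exists 0; last by rewrite addr0.
by rewrite /= oppr_le0 lez_nat leq0n.
Qed.

Lemma cyc_cclU A B : cyc_ccl (A `|` B) = cyc_ccl A `|` cyc_ccl B.
Proof. exact: bigcup_setU. Qed.

Definition cyc_cech : cechSpace := CechSpace cyc_ccl0 sub_cyc_ccl cyc_cclU.

End cyclic.

(* Main.v *)
Require Import Defs.
From mathcomp Require Import all_boot all_order all_algebra.
From mathcomp Require Import zify ring lra.
From mathcomp Require Import all_classical all_reals all_analysis.
Import Order.TTheory GRing.Theory Num.Theory.
Local Open Scope ring_scope.

Import numFieldNormedType.Exports.
Local Open Scope classical_set_scope.

(** A point of the closure space Z/n has a smallest neighborhood, the arc of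
    the residues at distance at most [m], so a map into it is continuous when
    near each point it moves by at most [m] steps.  The theorem is the covering
    space computation of the fundamental group of the circle, the covering
    being the reduction of the integers modulo [n], where the integers carry
    the closure structure with the same [m].

    The bound [3 * m < n] is what makes reduction a covering.  On a small
    neighborhood of a point, a path stays within [m] of its value there, so it
    has only one lift staying within [m] of a chosen lift of that value; two
    values of this lift differ by at most [2 * m].  The residues at two nearby
    points differ by a step of size at most [m], and the actual difference of
    the lifts is congruent to that step while the two are at most [3 * m]
    apart: they are equal, and the lift is continuous ([lifts_rep]).

    From this local fact, induction along the unit interval
    ([interval_induction]) gives lifts of paths ([lifts_exist]), uniqueness of
    their increments ([lifts_incr_unique]), and the invariance of the total
    increment under homotopy ([homotopy_lifts_incr]).  The increment of a lift
    of a loop is a multiple of [n]; the quotient is the winding number.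
    It is additive because the two halves of a lift of a concatenation lift the
    two factors, and onto because rounding down [k * n * t] lifts a loop
    that winds [k] times.

    A loop of winding number zero lifts to an integer-valued loop [F] at [0].
    It is contracted by truncating [F] to [[-c, c]] while the integer [c] falls
    to [0] in unit steps ([winding0_homotopic]).  Interpolating linearly and
    rounding would not do, as a step of size [m] may become [m + 1]; truncation
    does, because it is 1-Lipschitz in the pair [(c, F)] for the maximum
    distance, and [1 <= m]. *)

(** * Induction along an interval *)

Section interval_induction.
#[local] Set Implicit Arguments.
#[local] Unset Strict Implicit.
Variable R : realType.

Lemma near_interval (t : R) (Q : R -> Prop) : (\forall t' \near t, Q t') <->
  exists2 e, 0 < e & forall t', t - e < t' < t + e -> Q t'.
Proof.
split=> [/nbhs_ballP[e e0 Qe]|[e e0 Qe]].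
  by exists e => // t' tt'; apply: Qe; rewrite /ball/= distrC ltr_distl.
apply/nbhs_ballP; exists e => // t'; rewrite /ball/= distrC ltr_distl.
exact: Qe.
Qed.

(** This stands in for compactness and connectedness of [[a, b]] at once: the
    supremum of the points reachable from [a] is reached, because a short step
    leads to it, and is [b], because otherwise a short step leads beyond. *)
Lemma interval_induction (a b : R) (P : R -> R -> Prop) : a <= b ->
  (forall c d e, c <= d -> d <= e -> P c d -> P d e -> P c e) ->
  (forall t, a <= t <= b -> exists2 e, 0 < e &
     forall c d, a <= c -> c <= d -> d <= b -> t - e < c -> d < t + e -> P c d) ->
  P a b.
Proof.
move=> ab Ptrans Ploc.
pose S := [set t | a <= t <= b /\ P a t].
have Sa : S a.
  split; first by rewrite lexx.
  by have [|e e0] := Ploc a; [|apply]; lra.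
have Sb : ubound S b by move=> t [/andP[]].
have supS : has_sup S by split; [exists a|exists b].
have hb : has_ubound S by exists b.
have as_ : a <= sup S by exact: ub_le_sup hb _ Sa.
have sb : sup S <= b by apply: ge_sup Sb; exists a.
have [|e e0 Pe] := Ploc (sup S); first exact/andP.
have [c [/andP[ac cb] Pac] sc] := sup_adherent e0 supS.
have cs : c <= sup S.
  by apply: (ub_le_sup hb); split=> //; rewrite ac.
have [bs|sb'] := leP b (sup S).
  have -> : b = sup S by lra.
  by apply: (Ptrans a c) => //; apply: Pe => //; lra.
pose d := Num.min b (sup S + e / 2).
have [db ds] : d <= b /\ d <= sup S + e / 2.
  by rewrite /d; split; rewrite ge_min lexx ?orbT.
have sd : sup S < d by rewrite /d lt_min sb'/=; lra.
have : S d.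
  split; first by apply/andP; split; lra.
  by apply: (Ptrans a c) => //; [lra|apply: Pe => //; lra].
by move=> /(ub_le_sup hb); lra.
Qed.

End interval_induction.

(** * Lifting paths and homotopies to the integers *)

Section residues.
#[local] Set Implicit Arguments.
#[local] Unset Strict Implicit.
(** The ring [Z] stands for the residues modulo [n].  All that lifting uses of
    it is that no nonzero integer of size at most [3 * m] vanishes in it. *)
Variables (Z : nzRingType) (m : nat).
Hypothesis small_inj :
  forall j : int, `|j| <= (3 * m)%:Z -> j%:~R = 0 :> Z -> j = 0.

Definition small (a : Z) := exists2 j : int, `|j| <= m%:Z & j%:~R = a.

Definition rep (a : Z) : int :=
  xget 0 [set j : int | `|j| <= m%:Z /\ j%:~R = a].

Lemma repK a : small a -> (rep a)%:~R = a.
Proof.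
move=> [j jm ja]; rewrite /rep.
by have [] := @xgetPex _ 0 [set j : int | `|j| <= m%:Z /\ j%:~R = a]
  (ex_intro _ j (conj jm ja)).
Qed.

Lemma rep_le a : `|rep a| <= m%:Z.
Proof. by rewrite /rep; case: xgetP => [j _ []|_] //; rewrite normr0. Qed.

Lemma intr_small_eq (i j : int) :
  i%:~R = j%:~R :> Z -> `|i - j| <= (3 * m)%:Z -> i = j.
Proof.
move=> ij /small_inj ij0; apply/eqP; rewrite -subr_eq0 ij0// rmorphB/=.
by rewrite ij subrr.
Qed.

Section lifting.
Variable R : realType.

(** Continuity for the closure structure in which the smallest neighborhood of
    a point is the set of points differing from it by a small element. *)
Definition zcont (V : R -> Z) :=
  forall t, \forall t' \near t, small (V t' - V t).

Definition icont (F : R -> int) :=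
  forall t, \forall t' \near t, `|F t' - F t| <= m%:Z.

(** Only differences are compared, so that lifts may be shifted by any integer
    and need no base point. *)
Definition lifts (V : R -> Z) (a b : R) (F : R -> int) :=
  icont F /\ forall c d, a <= c <= b -> a <= d <= b ->
    (F d - F c)%:~R = V d - V c.

(** The neighborhoods of a point of the plane are generated by rectangles, as
    in the product of two closure spaces. *)
Definition zcont2 (K : R -> R -> Z) :=
  forall t s, exists A B, [/\ nbhs t A, nbhs s B &
    forall t' s', A t' -> B s' -> small (K t' s' - K t s)].

Lemma zcont2_l K s : zcont2 K -> zcont (K^~ s).
Proof.
move=> cK t; have [A [B [tA sB AB]]] := cK t s.
by apply: filterS tA => t' /AB; apply; exact: nbhs_singleton.
Qed.

Lemma zcont2_r K t : zcont2 K -> zcont (K t).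
Proof.
move=> cK s; have [A [B [tA sB AB]]] := cK t s.
by apply: filterS sB => s' /AB; apply; exact: nbhs_singleton.
Qed.

Lemma icont_comp (F : R -> int) (g : R -> R) :
  continuous g -> icont F -> icont (F \o g).
Proof. by move=> cg cF t; exact: (cg t _ (cF (g t))). Qed.

Lemma zcont_comp (V : R -> Z) (g : R -> R) :
  continuous g -> zcont V -> zcont (V \o g).
Proof. by move=> cg cF t; exact: (cg t _ (cF (g t))). Qed.

Lemma sub_lifts V a b c d F : a <= c -> d <= b -> lifts V a b F ->
  lifts V c d F.
Proof. by move=> ac db [cF VF]; split=> // t t' ? ?; apply: VF; lra. Qed.

(** The difference of two lifts is locally constant: it changes by at most
    [2 * m] near a point, and the change maps to zero in [Z]. *)
Lemma lifts_incr_unique V a b F G : a <= b -> lifts V a b F -> lifts V a b G ->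
  F b - F a = G b - G a.
Proof.
move=> ab [cF VF] [cG VG].
pose P c d := a <= c -> c <= d -> d <= b -> F d - G d = F c - G c.
suff : P a b by move=> /(_ (lexx _) ab (lexx _)) => h; lia.
apply: interval_induction => // [c d e cd de Pcd Pde ac _ eb|t tab].
  by rewrite Pde ?Pcd//; lra.
have /near_interval[e e0 He] : \forall t' \near t,
    `|F t' - F t| <= m%:Z /\ `|G t' - G t| <= m%:Z.
  exact: filterI (cF t) (cG t).
exists e => // c d ac cd db tc dt _ _ _.
suff E s : a <= s <= b -> t - e < s < t + e -> F s - G s = F t - G t.
  by rewrite !E//; lra.
move=> sab /He[Fs Gs].
have /intr_small_eq : (F s - F t)%:~R = (G s - G t)%:~R :> Z by rewrite VF ?VG.
by lia.
Qed.

Definition clip (a b t : R) := Num.max a (Num.min t b).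

Lemma clip_id a b t : a <= t <= b -> clip a b t = t.
Proof. by move=> /andP[at_ tb]; rewrite /clip min_l// max_r. Qed.

Lemma clip_itv a b t : a <= b -> a <= clip a b t <= b.
Proof. by move=> ab; rewrite /clip le_max lexx ge_max ab ge_min lexx orbT. Qed.

Lemma continuous_clip a b : continuous (clip a b).
Proof.
move=> t; apply: (@continuous_max R R (cst a) (fun y => Num.min y b)).
  exact: cvg_cst.
by apply: (@continuous_min R R id (cst b)); [exact: cvg_id|exact: cvg_cst].
Qed.

(** The local lift: its values are within [2 * m] of each other, so its
    difference at nearby points equals the step of [V] there, both having the
    same image in [Z] and being at most [3 * m] apart.  Clipping the argument to
    [[a, b]] makes the lift continuous on the whole line. *)
Lemma lifts_rep V a b z : zcont V -> a <= b ->
  (forall t, a <= t <= b -> small (V t - z)) ->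
  lifts V a b (fun t => rep (V (clip a b t) - z)).
Proof.
move=> cV ab Vz; split=> [t|c d cab dab]; last first.
  rewrite !clip_id// rmorphB/= !repK; [|exact: Vz..].
  by rewrite opprB addrA subrK.
have := @zcont_comp _ _ (@continuous_clip a b) cV t.
apply: filterS => t' [j jm] /= ej.
set r' := rep _; set r := rep _.
have r'm : `|r'| <= m%:Z by exact: rep_le.
have rm : `|r| <= m%:Z by exact: rep_le.
have -> : r' - r = j; last by [].
apply: intr_small_eq; last by lia.
rewrite ej rmorphB/= !repK; [|exact/Vz/clip_itv..].
by rewrite opprB addrA subrK.
Qed.

Lemma icont_glue (F G : R -> int) b : icont F -> icont G -> F b = G b ->
  icont (fun t => if t <= b then F t else G t).
Proof.
move=> cF cG FGb t.
have : \forall t' \near t,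
    [/\ `|F t' - F t| <= m%:Z, `|G t' - G t| <= m%:Z,
      (t < b -> t' < b) & (b < t -> b < t')].
  have lt_near : \forall t' \near t, t < b -> t' < b.
    have [tb|_] := ltP t b; last by apply/near_interval; exists 1.
    exact: filterS (lt_nbhsl tb).
  have gt_near : \forall t' \near t, b < t -> b < t'.
    have [tb|_] := ltP b t; last by apply/near_interval; exists 1.
    exact: filterS (lt_nbhsr tb).
  apply: filterS (filterI (filterI (cF t) (cG t)) (filterI lt_near gt_near)).
  by move=> t' [[? ?] [? ?]].
apply: filterS => t' [Ft Gt tb bt].
case: (ltgtP t b) tb bt => [_ /(_ isT)/ltW -> //|_ _|tb _ _].
  by rewrite ltNge => /(_ isT)/negPf ->.
by case: ifP => // _; rewrite tb FGb -tb.
Qed.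

Lemma lifts_exist V a b : zcont V -> a <= b -> exists F, lifts V a b F.
Proof.
move=> cV ab; apply: (@interval_induction _ _ _
    (fun a b => exists F, lifts V a b F))
  => // [c d e cd de|t tab].
  move=> [F [cF VF]] [G [cG VG]].
  (* The second lift is shifted to agree with the first at the common end. *)
  pose G' s := G s + (F d - G d).
  have cG' : icont G'.
    move=> s; move: (cG s); apply: filterS => s'.
    by rewrite /G' opprD addrACA subrr addr0.
  have FG' : F d = G' d by rewrite /G' addrC subrK.
  exists (fun t => if t <= d then F t else G' t); split.
    exact: icont_glue.
  suff E s : c <= s <= e ->
      ((if s <= d then F s else G' s) - F d)%:~R = V s - V d.
    move=> s t sce tce.
    have /(congr2 (fun x y => x - y) (E _ tce)) := E _ sce.
    by rewrite -rmorphB/= !opprB !addrA !subrK.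
  move=> sce; case: leP => sd; first by rewrite VF//; lra.
  by rewrite FG' /G' opprD addrACA subrr addr0 VG//; lra.
have /near_interval[e e0 He] := cV t.
exists e => // c d _ cd _ tc dt.
by exists (fun s => rep (V (clip c d s) - V t)); apply: lifts_rep => // s scd;
  apply: He; lra.
Qed.

Lemma lifts_incr_rep V a b z F : zcont V -> a <= b ->
  (forall t, a <= t <= b -> small (V t - z)) -> lifts V a b F ->
  F b - F a = rep (V b - z) - rep (V a - z).
Proof.
move=> cV ab Vz VF; rewrite (lifts_incr_unique ab VF (lifts_rep cV ab Vz)).
by rewrite !clip_id ?lexx ?ab.
Qed.

(** The lifts of neighboring paths of a homotopy are compared by [Q] below:
    along any interval [[c, d]], the increments of the lifts at [s] and at [s0] differ
    by the change, from [c] to [d], of the short jump from [K t s0] to [K t s].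
    This relation composes in [[c, d]] and holds on short intervals, where the
    path lifts by [rep]; the jumps vanish at the fixed ends. *)
Lemma homotopy_lifts_incr (K : R -> R -> Z) (F : R -> R -> int) :
  zcont2 K ->
  (forall s, lifts (K^~ s) 0 1 (F s)) ->
  (forall s s', K 0 s = K 0 s') -> (forall s s', K 1 s = K 1 s') ->
  F 0 1 - F 0 0 = F 1 1 - F 1 0.
Proof.
move=> cK KF K0 K1.
have ct s := zcont2_l s cK; have cs t := zcont2_r t cK.
pose P s s' := F s 1 - F s 0 = F s' 1 - F s' 0.
suff : P 0 1 by [].
suff loc s0 : \forall s \near s0, P s0 s.
  apply: interval_induction => // [c d e _ _|s0 _].
    exact: etrans.
  have /near_interval[e e0 He] := loc s0.
  exists e => // c d _ cd _ sc ds.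
  by apply: etrans (He d _); [apply/esym/He|]; lra.
pose Q (c d : R) := 0 <= c -> c <= d -> d <= 1 -> \forall s \near s0,
  (F s d - F s c) - (F s0 d - F s0 c) =
  rep (K d s - K d s0) - rep (K c s - K c s0).
suff : Q 0 1.
  move=> /(_ (lexx _) ler01 (lexx _)); apply: filterS => s.
  by rewrite (K0 s s0) (K1 s s0) !subrr => /subr0_eq/esym.
apply: (@interval_induction _ _ _ Q)
  => // [c d e cd de Qcd Qde c0 ce e1|t0 t001].
  have {}Qcd := Qcd c0 cd (le_trans de e1).
  have {}Qde := Qde (le_trans c0 cd) de e1.
  by move: Qcd Qde; apply: filterS2 => s; lia.
have [A [B [/near_interval[e e0 He] sB AB]]] := cK t0 s0.
exists e => // c d c0 cd d1 tc dt _ _ _.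
have cF s : B s ->
    F s d - F s c = rep (K d s - K t0 s0) - rep (K c s - K t0 s0).
  move=> Bs; apply: (@lifts_incr_rep (K^~ s)) => //.
    by move=> t tcd; apply: AB => //; apply: He; lra.
  by apply: sub_lifts (KF s).
have Bs0 : B s0 by exact: nbhs_singleton.
have rK s t : B s -> c <= t <= d -> small (K t s - K t s0) ->
    rep (K t s - K t s0) = rep (K t s - K t0 s0) - rep (K t s0 - K t0 s0).
  move=> Bs tcd Kts; have At : A t by apply: He; lra.
  have := rep_le (K t s - K t s0); have := rep_le (K t s - K t0 s0).
  have := rep_le (K t s0 - K t0 s0) => h1 h2 h3.
  apply: intr_small_eq; last by lia.
  rewrite rmorphB/= !repK//; [|exact: AB..].
  by rewrite opprB addrA subrK.
move: (sB) (cs c s0) (cs d s0); apply: filterS3 => s Bs Kc Kd.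
have cc : c <= c <= d by rewrite lexx.
have dd : c <= d <= d by rewrite lexx andbT.
rewrite !cF// (rK s c Bs cc Kc) (rK s d Bs dd Kd); lia.
Qed.

Lemma icont_bounded F a b : icont F -> a <= b ->
  exists M : nat, forall t, a <= t <= b -> `|F t| <= M%:Z.
Proof.
move=> cF ab; apply: (@interval_induction _ _ _
  (fun a b => exists M : nat, forall t, a <= t <= b -> `|F t| <= M%:Z))
  => // [c d e cd de [M FM] [N FN]|t _].
  exists (maxn M N) => t tce; have [td|dt] := leP t d.
    by apply: le_trans (FM t _) _; [lra|lia].
  by apply: le_trans (FN t _) _; [lra|lia].
have /near_interval[e e0 He] := cF t.
exists e => // c d _ cd _ tc dt; exists (absz (F t) + m)%N => s scd.
have : `|F s - F t| <= m%:Z by apply: He; lra.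
lia.
Qed.

End lifting.
End residues.

(** * Winding numbers *)

Lemma floor_near (R : realType) (y : R) :
  \forall y' \near y, `|Num.floor y' - Num.floor y| <= 1.
Proof.
apply/near_interval; exists 1 => // y' yy'.
have f1 := floor_le y; have f2 := floor_le y'.
have := floorD1_gt y; have := floorD1_gt y'; rewrite !intrD => f3 f4.
have h1 : (Num.floor y' < Num.floor y + 2).
  by rewrite -(ltr_int R) intrD; lra.
have h2 : (Num.floor y < Num.floor y' + 2).
  by rewrite -(ltr_int R) intrD; lra.
lia.
Qed.

Lemma continuous_affineR (R : realType) (a b : R) :
  continuous (fun t : R => a * t + b).
Proof.
by move=> t; apply: (@cvgD R R^o R); [apply: mulrl_continuous|exact: cvg_cst].
Qed.

Lemma icont_floor (R : realType) m (a : R) :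
  (1 <= m)%N -> icont m (fun t => Num.floor (a * t)).
Proof.
move=> m1 t; have : \forall t' \near t,
    `|Num.floor (a * t' + 0) - Num.floor (a * t + 0)| <= 1.
  exact: (@continuous_affineR _ a 0 t _ (floor_near _ _)).
by apply: filterS => t' /=; rewrite !addr0; lia.
Qed.

Section winding.
#[local] Set Implicit Arguments.
#[local] Unset Strict Implicit.
Variables n m : nat.
Hypotheses (m1 : (1 <= m)%N) (mn : (3 * m < n)%N).

Lemma intr_Zn_eq0 (j : int) : (j%:~R = 0 :> 'Z_n) -> (n %| j)%Z.
Proof.
have n1 : (1 < n)%N by lia.
move=> j0; have : (`|j|%N%:R : 'Z_n) = 0.
  by case: (intP j) j0 => [//|k|k]; rewrite ?abszN // rmorphN => /eqP;
    rewrite oppr_eq0 => /eqP.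
by move=> /(congr1 (fun a : 'Z_n => a : nat)); rewrite val_Zp_nat// => /eqP.
Qed.

Lemma intr_Zn_mul (k : int) : (k * n%:Z)%:~R = 0 :> 'Z_n.
Proof.
have n1 : (1 < n)%N by lia.
by rewrite intrM [X in _ * X]pchar_Zp// mulr0.
Qed.

Lemma small_inj_Zn (j : int) : `|j| <= (3 * m)%:Z -> j%:~R = 0 :> 'Z_n -> j = 0.
Proof.
move=> jm /intr_Zn_eq0/dvdzP[k jE]; move: jm; rewrite jE normrM => kn.
have [->|k0] := eqVneq k 0; first by rewrite mul0r.
have : 1 <= `|k| by lia.
nia.
Qed.

Lemma cnbhs_cyc (x : 'Z_n) (U : set 'Z_n) :
  @cnbhs (cyc_cech n m) x U <-> forall y : 'Z_n, small m (y - x) -> U y.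
Proof.
split=> [xU y [j jm jE]|xU [k nUk [j jm kx]]].
  apply: contrapT => nUy; apply: xU; exists y => //.
  exists (- j); first by rewrite /=; lia.
  by rewrite rmorphN/= jE opprB addrC subrK.
apply: nUk; apply: xU; exists (- j); first by move: jm => /=; lia.
by rewrite rmorphN/= -kx opprD addrA subrr add0r.
Qed.

Variable R : realType.
Local Notation Zc := (cyc_cech n m).

Lemma ccontinuous_lift (x : 'Z_n) (F : R -> int) : icont m F ->
  @ccontinuous (I R) Zc (fun t => x + (F (val t))%:~R).
Proof.
move=> cF; apply/ccontinuousP => t V /cnbhs_cyc tV; apply/cnbhs_topE.
have : \forall t' \near t, `|F (val t') - F (val t)| <= m%:Z.
  exact: (@continuous_uitv_val R t _ (cF (val t))).
apply: filterS => t' /= Ft.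
apply: tV; exists (F (val t') - F (val t)) => //.
by rewrite rmorphB/= opprD addrACA subrr add0r.
Qed.

Lemma ccontinuous_lift2 (x : 'Z_n) (G : R -> R -> int) :
  (forall t s, exists A B, [/\ nbhs t A, nbhs s B &
     forall t' s', A t' -> B s' -> `|G t' s' - G t s| <= m%:Z]) ->
  @ccontinuous (II R) Zc (fun p => x + (G (val p.1) (val p.2))%:~R).
Proof.
move=> cG; apply/ccontinuousP => p V /cnbhs_cyc pV; apply/cnbhs_prodP.
have [A [B [pA pB AB]]] := cG (val p.1) (val p.2).
exists ((val : uitv R -> R) @^-1` A), ((val : uitv R -> R) @^-1` B); split.
- by apply/cnbhs_topE; exact: continuous_uitv_val pA.
- by apply/cnbhs_topE; exact: continuous_uitv_val pB.
move=> q [qA qB]; apply: pV.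
exists (G (val q.1) (val q.2) - G (val p.1) (val p.2)); first exact: AB.
by rewrite rmorphB/= opprD addrACA subrr add0r.
Qed.

Lemma ccontinuous_clampR : @ccontinuous (top_cech R) (I R) (@clamp R).
Proof.
apply: (@ccontinuous_top R (uitv R)).
by apply: (@continuous_clamp_comp R R id) => t; exact: cvg_id.
Qed.

Section based.
Variable x : Zc.
Local Notation loop := (@loop R Zc x).

Definition path_of (v : loop) (t : R) : 'Z_n := v (clamp t).

Lemma path_of0 (v : loop) : path_of v 0 = x.
Proof. by rewrite /path_of clamp_le0// loop_0. Qed.

Lemma path_of1 (v : loop) : path_of v 1 = x.
Proof. by rewrite /path_of clamp_ge1// loop_1. Qed.

Lemma path_of_cont (v : loop) : zcont m (path_of v).
Proof.
move=> t; apply/(@cnbhs_topE R).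
have /ccontinuousP := ccontinuous_comp ccontinuous_clampR (@loop_cont _ _ _ v).
move=> /(_ t [set y : 'Z_n | small m (y - path_of v t)]).
by apply; apply/cnbhs_cyc.
Qed.

Lemma winding_exists (v : loop) : exists k : int, forall F,
  lifts m (path_of v) 0 1 F -> F 1 - F 0 = k * n%:Z.
Proof.
have [F vF] := lifts_exist (@small_inj_Zn) (@path_of_cont v) (@ler01 R).
have /intr_Zn_eq0/dvdzP[k kE] : (F 1 - F 0)%:~R = 0 :> 'Z_n.
  by rewrite vF.2 ?lexx ?ler01// path_of0 path_of1 subrr.
exists k => G vG; rewrite -kE.
exact: (lifts_incr_unique (@small_inj_Zn)) vG vF.
Qed.

Definition winding (v : loop) : int := projT1 (cid (winding_exists v)).

Lemma windingP (v : loop) F :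
  lifts m (path_of v) 0 1 F -> F 1 - F 0 = winding v * n%:Z.
Proof. exact: (projT2 (cid (winding_exists v))). Qed.

Lemma loop_lifts (v : loop) : exists F, lifts m (path_of v) 0 1 F.
Proof.
have [F ?] := lifts_exist (@small_inj_Zn) (@path_of_cont v) (@ler01 R).
by exists F.
Qed.

Lemma mul_period_inj (k l : int) : k * n%:Z = l * n%:Z -> k = l.
Proof. by apply: mulIf; lia. Qed.

Lemma winding_homotopic (v w : loop) : homotopic v w -> winding v = winding w.
Proof.
move=> [H [cH H0 H1 Hl Hr]].
pose K (t s : R) : 'Z_n := H (clamp t, clamp s).
have cK : zcont2 m K.
  move=> t s.
  have cc := ccontinuous_prodmap ccontinuous_clampR ccontinuous_clampR.
  have /ccontinuousP := ccontinuous_comp cc cH.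
  move=> /(_ (t, s) _ ((cnbhs_cyc (K t s) _).2 (fun _ => id))).
  move=> /cnbhs_prodP[A [B [/cnbhs_topE tA /cnbhs_topE sB AB]]].
  exists A, B; split=> // t' s' At Bs; exact: (AB (t', s')).
have /choice[F KF] s : exists F, lifts m (K^~ s) 0 1 F.
  have [F ?] := lifts_exist (@small_inj_Zn) (zcont2_l s cK) (@ler01 R).
  by exists F.
have Kv : K^~ 0 = path_of v.
  by apply/funext => t; rewrite /K (@clamp_le0 _ 0)// H0.
have Kw : K^~ 1 = path_of w.
  by apply/funext => t; rewrite /K (@clamp_ge1 _ 1)// H1.
apply: mul_period_inj.
rewrite -(@windingP v (F 0)) -?Kv// -(@windingP w (F 1)) -?Kw//.
apply: (homotopy_lifts_incr (@small_inj_Zn) cK KF) => s s'.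
  by rewrite /K clamp_le0// !Hl.
by rewrite /K clamp_ge1// !Hr.
Qed.

(** A lift of the concatenation, read at half speed on each half of the
    interval, lifts the corresponding loop. *)
Lemma winding_concat (v w : loop) :
  winding (concat v w) = winding v + winding w.
Proof.
have [F vwF] := loop_lifts (concat v w).
have E1 (t : R) : 0 <= t <= 1 -> path_of (concat v w) (2^-1 * t) = path_of v t.
  move=> t01; rewrite /path_of /= /concat_fun val_clamp; last by lra.
  by rewrite ifT; [congr (v (clamp _)); field|lra].
have E2 (t : R) : 0 <= t <= 1 ->
    path_of (concat v w) (2^-1 * t + 2^-1) = path_of w t.
  move=> t01; rewrite /path_of /= /concat_fun val_clamp; last by lra.
  case: ifP => t0; last by congr (w (clamp _)); field.
  have -> : t = 0 by lra.
  by rewrite clamp_ge1 ?clamp_le0 ?loop_0 ?loop_1//; lra.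
have lF1 : lifts m (path_of v) 0 1 (F \o (fun t => 2^-1 * t + 0)).
  split; first by apply: icont_comp vwF.1; apply: continuous_affineR.
  by move=> c d c01 d01; rewrite /= !addr0 vwF.2 ?E1//; lra.
have lF2 : lifts m (path_of w) 0 1 (F \o (fun t => 2^-1 * t + 2^-1)).
  split; first by apply: icont_comp vwF.1; apply: continuous_affineR.
  by move=> c d c01 d01; rewrite /= vwF.2 ?E2//; lra.
apply: mul_period_inj.
rewrite mulrDl -(windingP vwF) -(windingP lF1) -(windingP lF2).
rewrite /= mulr0 mulr1 !addr0 add0r (_ : 2^-1 + 2^-1 = 1 :> R); last by field.
by rewrite [RHS]addrC subrKA.
Qed.

(** The bound [c s] falls from a bound [M] of the lift to [0], by unit jumps.
    Truncation to [[- c s, c s]] is the identity at [s = 0] and gives the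
    constant loop at [s = 1]; it fixes the value [0] of the lift at both ends. *)
Lemma winding0_homotopic (v : loop) :
  winding v = 0 -> homotopic v (cst_loop R x).
Proof.
have [F0 vF0] := loop_lifts v; move=> v0.
pose F t := F0 t - F0 0.
have cF : icont m F.
  by move=> t; move: (vF0.1 t); apply: filterS => t';
    rewrite /F opprB addrA subrK.
have F00 : F 0 = 0 by rewrite /F subrr.
have F10 : F 1 = 0 by rewrite /F (windingP vF0) v0 mul0r.
have vF (t : I R) : v t = (x : 'Z_n) + (F (val t))%:~R.
  rewrite vF0.2 ?lexx ?ler01 ?uitv_ge0 ?uitv_le1// path_of0 /path_of clampK.
  by rewrite addrC subrK.
have [M FM] := icont_bounded cF (@ler01 R).
pose c (s : R) := Num.floor (- M%:R * s + M%:R).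
pose G t s := Num.max (- c s) (Num.min (c s) (F t)).
have c0 (s : R) : s <= 1 -> 0 <= c s.
  by move=> s1; rewrite /c floor_ge0 mulNr addrC subr_ge0 ler_piMr.
have cc (s : R) : \forall s' \near s, `|c s' - c s| <= 1.
  exact: (@continuous_affineR _ (- M%:R) M%:R s _ (floor_near _ _)).
have trunc0 (y : int) : 0 <= y -> Num.max (- y) (Num.min y 0) = 0 by lia.
exists (fun p : II R => (x : 'Z_n) + (G (val p.1) (val p.2))%:~R); split.
- apply: ccontinuous_lift2 => t s.
  exists [set t' | `|F t' - F t| <= m%:Z], [set s' | `|c s' - c s| <= 1].
  split; [exact: cF|exact: cc|move=> t' s' /=].
  by rewrite /G => Ft cs; lia.
- move=> t; rewrite vF /G/= /c mulr0 add0r -[M%:R]/(M%:Z%:~R) intrKfloor.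
  have truncE (y : int) : `|y| <= M%:Z -> Num.max (- M%:Z) (Num.min M%:Z y) = y.
    by lia.
  by rewrite truncE//; apply: FM; rewrite uitv_ge0 uitv_le1.
- move=> t; rewrite /= /G /c mulr1 addNr floor0.
  by rewrite (_ : Num.max _ _ = 0) ?addr0//; lia.
- move=> s; rewrite /= /G F00 trunc0 ?addr0//.
  exact/c0/uitv_le1.
- move=> s; rewrite /= /G F10 trunc0 ?addr0//.
  exact/c0/uitv_le1.
Qed.

Lemma winding_surj (k : int) : exists v : loop, winding v = k.
Proof.
pose a : R := (k * n%:Z)%:~R.
pose F (t : R) := Num.floor (a * t).
have cF : icont m F by exact: icont_floor.
have F0 : F 0 = 0 by rewrite /F mulr0 floor0.
have F1 : F 1 = k * n%:Z by rewrite /F mulr1 intrKfloor.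
pose f (t : I R) : Zc := (x : 'Z_n) + (F (val t))%:~R.
have f0 : f (uitv0 R) = x by rewrite /f /= F0 addr0.
have f1 : f (uitv1 R) = x by rewrite /f /= F1 intr_Zn_mul addr0.
pose v : loop := Loop (ccontinuous_lift (x := x) cF) f0 f1.
have vE (t : R) : 0 <= t <= 1 -> path_of v t = (x : 'Z_n) + (F t)%:~R.
  by move=> t01; rewrite -[in RHS](val_clamp t01).
exists v; apply: mul_period_inj; rewrite -(windingP (F := F)) ?F1 ?F0 ?subr0//.
split=> // c d c01 d01.
by rewrite !vE// rmorphB/= opprD addrACA subrr add0r.
Qed.

End based.
End winding.

Theorem corollary4p50 (R : realType) (m n : nat) (hm : (1 <= m)%N)
    (hmn : m%:Q < n%:Q / 3) (x : cyc_cech n m) :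
  exists f : pi1 R x -> int,
    bijective f /\ forall a b : pi1 R x, f (a * b)%g = f a + f b.
Proof.
have mn : (3 * m < n)%N.
  by move: hmn; rewrite ltr_pdivlMr// -[X in _ * X]/(3%:~R) -intrM ltr_int; lia.
pose f (a : pi1 R x) := winding hm mn (repr a).
have fE (v : loop R x) : f (pi1_class v) = winding hm mn v.
  exact/winding_homotopic/repr_pi1_class.
have fM (a b : pi1 R x) : f (a * b)%g = f a + f b.
  by rewrite -[a]pi1_classK -[b]pi1_classK pi1_classM !fE winding_concat.
(* Being multiplicative, [f] is injective once its kernel is trivial. *)
have f_ker (a : pi1 R x) : f a = 0 -> a = 1%g.
  move=> a0; rewrite -[a]pi1_classK; apply/pi1_classP.
  exact: winding0_homotopic a0.
have f1 : f 1%g = 0.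
  by apply: (addrI (f 1%g)); rewrite -fM mulg1 addr0.
have f_inj : injective f.
  move=> a b ab; have /f_ker : f (a * b^-1)%g = 0.
    by rewrite fM ab -fM mulgV f1.
  by move=> /(congr1 (fun c => c * b)%g); rewrite mulgVK mul1g.
have /choice[g gK] (k : int) : exists a, f a = k.
  by have [v vk] := winding_surj hm mn R x k; exists (pi1_class v); rewrite fE.
by exists f; split => //; exists g => // a; apply: f_inj; rewrite gK.
Qed.
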